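(* Let $n\ge 3$ and let $\mathcal{A}\in\mathcal{H}(s_{i,j})$ be a complete hypertetrahedral arrangement in $\mathbb{P}^n$. If $\mathcal{A}$ is general, then $\mathcal{A}$ is not locally free.
   Context: $\Bbbk$ is an algebraically closed field of characteristic $0$, $R=\Bbbk[x_0,\dots,x_n]$, $\mathbb{P}^n=\mathrm{Proj}(R)$. A hyperplane arrangement $\mathcal{A}$ is a finite set of distinct hyperplanes in $\mathbb{P}^n$; $f_{\mathcal{A}}$ denotes the product of linear forms defining its hyperplanes. $\mathrm{Der}(-\log\mathcal{A})=\{\theta\in \mathrm{Der}_{\Bbbk}(R): \theta(f_{\mathcal{A}})\in (f_{\mathcal{A}})\}$, $\theta_E=\sum_i x_i\partial_{x_i}$ is the Euler derivation, and $\mathcal{T}_{\mathcal{A}}$ is the sheaf on $\mathbb{P}^n$ associated to $\mathrm{Der}(-\log\mathcal{A})/R\theta_E$. $\mathcal{A}$ is locally free if $\mathcal{T}_{\mathcal{A}}$ is a locally free sheaf. For $0\le i<j\le n$ let $\mathcal{L}_{i,j}=\{x_i=x_j=0\}$. A hypertetrahedral arrangement in $\mathbb{P}^n$ is one in which every hyperplane contains some $\mathcal{L}_{i,j}$; it is complete if it contains all coordinate hyperplanes $\{x_i=0\}$, $0\le i\le n$. For integers $s_{i,j}\ge 1$ ($0\le i<j\le n$), $\mathcal{H}(s_{i,j})$ is the set of complete hypertetrahedral arrangements with exactly $s_{i,j}+2$ hyperplanes through $\mathcal{L}_{i,j}$ for all $i<j$. A hypertetrahedral arrangement is general if any intersection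 of its hyperplanes outside the coordinate $n$-simplex has minimal dimension; that is, whenever $X$ is a nonempty intersection of hyperplanes of $\mathcal{A}$ that is not contained in the union of the coordinate hyperplanes, the codimension of $X$ in $\mathbb{P}^n$ equals the number of hyperplanes of $\mathcal{A}$ containing $X$. *)

(* Defs.v *)
From HB Require Import structures.
From mathcomp Require Import all_boot all_order all_algebra.
From mathcomp Require Import mpoly.

Set Implicit Arguments.
Unset Strict Implicit.
Unset Printing Implicit Defensive.

Import GRing.Theory.
Local Open Scope ring_scope.

(* Linear subspaces of P^n are represented by their affine cones, which are   *)
(* subspaces of k^(n+1); the empty set is the zero subspace.                  *)
Section Hyperplanes.
Variables (k : closedFieldType) (n : nat).

Definition linear_form (a : 'rV[k]_n.+1) : {mpoly k[n.+1]} :=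
  \sum_(i < n.+1) a 0 i *: 'X_i.

Definition hyperplane (a : 'rV[k]_n.+1) : {vspace 'rV[k]_n.+1} :=
  lker (linfun (mulmxr a^T : 'rV[k]_n.+1 -> 'rV[k]_1)).

Lemma mem_hyperplane a v :
  (v \in hyperplane a) = ((linear_form a).@[fun i => v 0 i] == 0).
Proof.
have E : v *m a^T = (linear_form a).@[fun i => v 0 i]%:M.
  apply/matrixP=> i j; rewrite !ord1 !mxE mulr1n /linear_form raddf_sum /=.
  by apply: eq_bigr => l _; rewrite mevalZ mevalXU !mxE mulrC.
rewrite /hyperplane memv_ker lfunE /= E; apply/eqP/eqP => [/matrixP|->].
  by move/(_ 0 0); rewrite !mxE mulr1n.
by rewrite raddf0.
Qed.

Definition coord_hyperplane (i : 'I_n.+1) : {vspace 'rV[k]_n.+1} :=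
  hyperplane (delta_mx 0 i).

Definition coord_codim2 (i j : 'I_n.+1) : {vspace 'rV[k]_n.+1} :=
  (coord_hyperplane i :&: coord_hyperplane j)%VS.

Lemma mem_coord_hyperplane i v : (v \in coord_hyperplane i) = (v 0 i == 0).
Proof.
rewrite mem_hyperplane /linear_form raddf_sum (bigD1 i) //= big1 => [|j ji].
  by rewrite addr0 mevalZ mevalXU mxE !eqxx mul1r.
by rewrite mevalZ mxE (negPf ji) andbF mul0r.
Qed.

Definition proj_codim (X : {vspace 'rV[k]_n.+1}) : nat := (n.+1 - \dim X)%N.

End Hyperplanes.

Record arrangement (k : closedFieldType) (n : nat) := Arrangement {
  nb_hyp : nat;
  hyp_form : 'I_nb_hyp -> 'rV[k]_n.+1;
  hyp_form_neq0 : forall t, hyp_form t != 0;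
  hyp_form_distinct : injective (fun t => hyperplane (hyp_form t))
}.

Section Arrangements.
Variables (k : closedFieldType) (n : nat).
Implicit Type A : arrangement k n.

Definition hyp A (t : 'I_(nb_hyp A)) : {vspace 'rV[k]_n.+1} :=
  hyperplane (hyp_form t).

Definition defining_poly A : {mpoly k[n.+1]} :=
  \prod_(t < nb_hyp A) linear_form (hyp_form t).

Definition hypertetrahedral A : Prop :=
  forall t : 'I_(nb_hyp A),
    exists i j : 'I_n.+1, (i < j)%N /\ (coord_codim2 k i j <= hyp t)%VS.

Definition complete A : Prop :=
  forall i : 'I_n.+1, exists t : 'I_(nb_hyp A), hyp t = coord_hyperplane k i.

(* Only the values s i j with i < j are relevant. *)
Definition in_calH (s : 'I_n.+1 -> 'I_n.+1 -> nat) A : Prop :=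
  [/\ hypertetrahedral A, complete A &
      forall i j : 'I_n.+1, (i < j)%N ->
        #|[set t : 'I_(nb_hyp A) | (coord_codim2 k i j <= hyp t)%VS]|
          = (s i j + 2)%N].

(* A point with no zero coordinate witnesses both that the intersection is    *)
(* nonempty and that it is not inside the union of the coordinate hyperplanes.*)
Definition general A : Prop :=
  forall B : {set 'I_(nb_hyp A)},
    let X := (\bigcap_(t in B) hyp t)%VS in
    (exists2 p : 'rV[k]_n.+1, p \in X &
       forall i : 'I_n.+1, p \notin coord_hyperplane k i) ->
    proj_codim X = #|[set t : 'I_(nb_hyp A) | (X <= hyp t)%VS]|.

End Arrangements.

(* The vector theta stands for the derivation \sum_i theta_i d/dx_i.          *)
Section Derivations.
Variables (k : closedFieldType) (n : nat).
Local Notation R := {mpoly k[n.+1]}.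

Definition der (theta : 'rV[R]_n.+1) (p : R) : R :=
  \sum_(i < n.+1) theta 0 i * p^`M(i).

Definition is_derivation (D : R -> R) : Prop :=
  (forall (c : k) (p q : R), D (c *: p + q) = c *: D p + D q) /\
  (forall p q : R, D (p * q) = D p * q + p * D q).

Lemma der_is_derivation theta : is_derivation (der theta).
Proof.
split=> [c p q|p q]; rewrite /der.
  rewrite scaler_sumr -big_split /=; apply: eq_bigr => i _.
  by rewrite mderivD mderivZ mulrDr scalerAr.
rewrite mulr_suml mulr_sumr -big_split /=; apply: eq_bigr => i _.
by rewrite mderivM mulrDr !mulrA [p * _]mulrC.
Qed.

Lemma der_X theta (i : 'I_n.+1) : der theta 'X_i = theta 0 i.
Proof.
rewrite /der (bigD1 i) //= big1 => [|j ji].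
  rewrite addr0 mderivX mnm1E eqxx scale1r.
  by rewrite (_ : (U_(i) - U_(i))%MM = 0%MM) ?mpolyX0 ?mulr1 //;
     apply/mnmP=> l; rewrite mnmBE mnm0E subnn.
by rewrite mderivX mnm1E eq_sym (negPf ji) scale0r mulr0.
Qed.

Lemma derivation_eq (D E : R -> R) : is_derivation D -> is_derivation E ->
  (forall i : 'I_n.+1, D 'X_i = E 'X_i) -> D =1 E.
Proof.
move=> [Dl DM] [El EM] DE.
have one (F : R -> R) : (forall p q : R, F (p * q) = F p * q + p * F q) ->
    F 1 = 0.
  move=> FM; have /eqP := FM 1 1.
  by rewrite !mulr1 mul1r -[X in X == _]addr0 (inj_eq (addrI _)) => /eqP.
have zero (F : R -> R) : (forall p q : R, F (p * q) = F p * q + p * F q) ->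
    F 0 = 0.
  by move=> FM; have := FM 0 0; rewrite !mul0r !mulr0 addr0.
have DEX (m : 'X_{1..n.+1}) : D 'X_[m] = E 'X_[m].
  rewrite mpolyXE_id; apply: (big_ind (fun p => D p = E p)).
  - by rewrite one // one.
  - by move=> p q Hp Hq; rewrite DM EM Hp Hq.
  move=> i _; elim: (m i) => [|e IHe]; first by rewrite expr0 one // one.
  by rewrite exprS DM EM IHe DE.
elim/mpolyind => [|c m p _ _ IHp]; first by rewrite zero // zero.
by rewrite Dl El DEX IHp.
Qed.

Lemma derivationE (D : R -> R) :
  is_derivation D -> D =1 der (\row_i D 'X_i).
Proof.
move=> HD; apply: derivation_eq HD (der_is_derivation _) _ => i.
by rewrite der_X mxE.
Qed.

(* d/dx_i has degree -1, so theta has degree e when its coefficients are      *)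
(* forms of degree e + 1; with this grading the Euler derivation has degree 0.*)
Definition der_homog (e : nat) (theta : 'rV[R]_n.+1) : Prop :=
  forall i : 'I_n.+1, theta 0 i \is e.+1.-homog.

Definition euler : 'rV[R]_n.+1 := \row_(i < n.+1) 'X_i.

Definition euler_multiple (theta : 'rV[R]_n.+1) : Prop :=
  exists g : R, theta = g *: euler.

Definition log_der (A : arrangement k n) (theta : 'rV[R]_n.+1) : Prop :=
  exists g : R, der theta (defining_poly A) = g * defining_poly A.

End Derivations.

(* A pair (x, a) stands for the fraction x / f^a.  When N is a submodule of V,*)
(* frac_eq f N is equality in the localization (V / N)_f.                     *)
Section Fractions.
Variables (R : comNzRingType) (f : R).

Definition frac_eq (V : lmodType R) (N : V -> Prop) (x y : V * nat) : Prop :=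
  exists c : nat, N (f ^+ c *: (f ^+ y.2 *: x.1 - f ^+ x.2 *: y.1)).

Definition frac_add (V : lmodType R) (x y : V * nat) : V * nat :=
  (f ^+ y.2 *: x.1 + f ^+ x.2 *: y.1, (x.2 + y.2)%N).

Definition frac_scale (V : lmodType R) (c : R * nat) (x : V * nat) : V * nat :=
  (c.1 *: x.1, (c.2 + x.2)%N).

Definition frac_lincomb (V : lmodType R) (r : nat)
    (c : 'I_r -> R * nat) (e : 'I_r -> V * nat) : V * nat :=
  \big[@frac_add V/(0, 0%N)]_(l < r) frac_scale (c l) (e l).

Definition frac_basis (V : lmodType R) (N : V -> Prop)
    (S : R * nat -> Prop) (M : V * nat -> Prop)
    (r : nat) (e : 'I_r -> V * nat) : Prop :=
  [/\ forall l, M (e l),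
      forall x, M x -> exists2 c : 'I_r -> R * nat,
        forall l, S (c l) & frac_eq N x (frac_lincomb c e) &
      forall c : 'I_r -> R * nat, (forall l, S (c l)) ->
        frac_eq N (frac_lincomb c e) (0, 0%N) ->
        forall l, frac_eq (V := R^o) (fun g => g = 0) (c l) (0, 0%N)].

End Fractions.

Section LocallyFree.
Variables (k : closedFieldType) (n : nat).
Local Notation R := {mpoly k[n.+1]}.

Record proj_point (P : R -> Prop) : Prop := ProjPoint {
  proj_point0 : P 0;
  proj_pointD : forall p q, P p -> P q -> P (p + q);
  proj_pointM : forall p q, P q -> P (p * q);
  proj_point_prime : forall p q, P (p * q) -> P p \/ P q;
  proj_point_homog : forall p d, P p -> P (pihomog mdeg d p);
  proj_point_relevant : exists i : 'I_n.+1, ~ P 'X_i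
}.

(* For f a form of degree d: the degree 0 parts of R_f and of                 *)
(* Der(-log A)_f, the latter before dividing by the Euler derivation.         *)
Definition fun_frac (d : nat) (x : R * nat) : Prop :=
  x.1 \is (x.2 * d).-homog.

Definition log_frac (A : arrangement k n) (d : nat)
    (x : 'rV[R]_n.+1 * nat) : Prop :=
  log_der A x.1 /\ der_homog (x.2 * d) x.1.

(* On D_+(f) = Spec R_(f) the sheaf T_A is associated with the R_(f)-module   *)
(* (Der(-log A) / R theta_E)_(f), hence it is free there iff this module is.  *)
Definition free_on (A : arrangement k n) (d : nat) (f : R) : Prop :=
  exists (r : nat) (e : 'I_r -> 'rV[R]_n.+1 * nat),
    frac_basis f (@euler_multiple k n) (fun_frac d) (log_frac A d) e.

Definition locally_free (A : arrangement k n) : Prop :=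
  forall P : R -> Prop, proj_point P ->
    exists (d : nat) (f : R),
      [/\ (0 < d)%N, f \is d.-homog, ~ P f & free_on A d f].

End LocallyFree.

(* Main.v *)
(* Let theta = \sum_i x_i A_i d/dx_i be logarithmic and let P_ij be the       *)
(* product of the forms of A in which both x_i and x_j occur; then P_ij       *)
(* divides A_i - A_j. At the generic point of {x_0 = x_1 = x_2 = 0}, which    *)
(* exists as n >= 3, the other P_ij are units, so that the stalk of T_A is    *)
(* the syzygy module of (P_01, P_12, P_02) plus a free module of rank n - 2.  *)
(* Generality says that no three linear factors of P_01, P_12, P_02 are       *)
(* dependent, so their Koszul complex is exact; as s_ij >= 1 they are         *)
(* nonunits, and the syzygy module, of rank 2, needs 3 generators.            *)
(* Hence the stalk has rank n but needs n + 1 generators: the derivations     *)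
(* F_j d/dx_j, F_j being the product of the forms in which x_j occurs, are    *)
(* independent modulo the maximal ideal.                                      *)

Require Import Defs.
From mathcomp Require Import all_boot all_order all_algebra.
From mathcomp Require Import mpoly.
From HB Require Import structures.
From mathcomp Require Import ring zify.

Set Implicit Arguments.
Unset Strict Implicit.
Unset Printing Implicit Defensive.
Import GRing.Theory.

(** Let P be the prime ideal (x_0, x_1, x_2), a point of P^n because n >= 3, and suppose that T_A
    has a basis e_1, ..., e_r on a neighbourhood D_+(f) of it. Counting gives the contradiction: r
    <= n, while the n + 1 derivations F_m d/dx_m ([coord_der]) are independent modulo P.

    The bound is [homog_independent_rank]: more than n of the e_l would be dependent together with
    the Euler derivation in R^(n+1). On the other hand, by [coord_der_span] each F_m d/dx_m is, up
    to a factor outside P, a combination of the e_l and the Euler derivation. These n + 1 rows of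
    length r are dependent modulo P ([left_dependence]), so a combination of the F_m d/dx_m with
    coefficients not all in P lies in P Der(-log A) + R theta_E. This is excluded by
    [coord_der_minimal].

    The exclusion rests on [general_koszul_exact]. Dependent linear factors of P_ij, P_jl, P_li
    ([pair_prod]), one of each, would have a common zero space of codimension at most 2 that lies on
    three hyperplanes and leaves the coordinate simplex, against generality. Koszul exactness then
    passes from the factors to the products. Since s_ij >= 1, the three products lie in P, and so do
    the entries of all their syzygies. *)

Definition dvdr (R : comNzRingType) (a b : R) : Prop :=
  exists q, (b = a * q)%R.

(** * Exactness of the Koszul complex of three elements *)

Section KoszulExactness.
Local Open Scope ring_scope.
Variable R : idomainType.
Implicit Types a b c : R.

(** Vanishing of the first Koszul homology: every syzygy is a combination of (b, -a, 0), (c, 0, -a)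
    and (0, c, -b). *)
Definition koszul_exact a b c : Prop :=
  forall u v w, a * u + b * v + c * w = 0 ->
    exists g h l,
      [/\ u = b * g + c * h, v = c * l - a * g & w = - (a * h) - b * l].

Lemma koszul_exact_rot a b c : koszul_exact a b c -> koszul_exact b c a.
Proof.
move=> H u v w E; have [|g [h [l [-> -> ->]]]] := H w u v.
  by rewrite -E; ring.
by exists l, (- g), (- h); split; ring.
Qed.

(** A syzygy (u, v, w) of (a a', b, c) gives the syzygy (a' u, v, w) of (a, b, c), and the resulting
    formula for a' u is in turn a syzygy of (a', b, c). *)
Lemma koszul_exact_mul a a' b c :
  koszul_exact a b c -> koszul_exact a' b c -> koszul_exact (a * a') b c.
Proof.
move=> H H' u v w E.
have [|g [h [l [E1 -> ->]]]] := H (a' * u) v w; first by rewrite -E; ring.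
have [|g' [h' [l' [-> Eg Eh]]]] := H' u (- g) (- h).
  by rewrite E1; ring.
exists g', h', (l + a * l'); split; first by [].
  by rewrite -mulrA -[g]opprK Eg; ring.
by rewrite -[h]opprK Eh; ring.
Qed.

Lemma koszul_exact_prod (I : finType) (P : pred I) (F : I -> R) b c :
  (forall i, P i -> koszul_exact (F i) b c) ->
  koszul_exact (\prod_(i | P i) F i) b c.
Proof.
move=> H; apply: (big_ind (fun a => koszul_exact a b c)) => //.
  move=> u v w E; exists (- v), (- w), 0; split; try ring.
  by rewrite -[RHS]addr0 -E; ring.
by move=> a a'; apply: koszul_exact_mul.
Qed.

Lemma koszul_exact_prod3 (I : finType) (P Q S : pred I) (F : I -> R) :
  (forall i j l, P i -> Q j -> S l -> koszul_exact (F i) (F j) (F l)) ->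
  koszul_exact (\prod_(i | P i) F i) (\prod_(i | Q i) F i)
    (\prod_(i | S i) F i).
Proof.
move=> H; apply: koszul_exact_prod => i Pi.
do 2![apply: koszul_exact_rot]; apply: koszul_exact_prod => j Qj.
do 2![apply: koszul_exact_rot]; apply: koszul_exact_prod => l Sl.
by do 2![apply: koszul_exact_rot]; apply: H.
Qed.

End KoszulExactness.

(** * Linear dependence modulo a prime *)

Section Dependence.
Local Open Scope ring_scope.
Variables (R : comNzRingType) (S : idomainType) (rho : {rmorphism R -> S}).

(** Gaussian elimination without division: pivots are taken outside the kernel of [rho], and as [S]
    is a domain their products stay outside. A column without pivot vanishes under [rho] and is
    dropped. *)
Lemma left_dependence m q (C : 'I_m -> 'I_q -> R) : (q < m)%N ->
  exists2 lam : 'I_m -> R, exists i, rho (lam i) != 0 &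
    forall j, rho (\sum_i lam i * C i j) = 0.
Proof.
elim: q m C => [|q IH] [//|m] C lt_qm.
  exists (fun=> 1) => [|[]//].
  by exists ord0; rewrite rmorph1 oner_neq0.
case: (pickP (fun i => rho (C i ord0) != 0)) => [i0 nz|C0]; last first.
  have [|lam nz E] := IH m.+1 (fun i j => C i (lift ord0 j)); first by lia.
  exists lam => // j; have [j' ->|->] := unliftP ord0 j; first exact: E.
  rewrite rmorph_sum big1 // => i _; rewrite rmorphM.
  by have /negbFE/eqP -> := C0 i; rewrite mulr0.
pose a := C i0 ord0.
have [|lam [i1 nz1] E] := IH m (fun i j => a * C (lift i0 i) (lift ord0 j)
   - C (lift i0 i) ord0 * C i0 (lift ord0 j)); first by lia.
(* With the other rows scaled by the pivot [a], this coefficient of row [i0] makes column 0 cancel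
   exactly. *)
pose lam' i := if unlift i0 i is Some i' then a * lam i'
               else - \sum_i' lam i' * C (lift i0 i') ord0.
have sumE j : \sum_i lam' i * C i j =
    \sum_i' lam i' * (a * C (lift i0 i') j - C (lift i0 i') ord0 * C i0 j).
  rewrite (bigD1_ord i0) //= {1}/lam' unlift_none mulNr mulr_suml -sumrN.
  rewrite -big_split /=; apply: eq_bigr => i _.
  by rewrite /lam' liftK; ring.
exists lam' => [|j].
  by exists (lift i0 i1); rewrite /lam' liftK rmorphM mulf_neq0.
rewrite sumE; have [j' ->|->] := unliftP ord0 j; first exact: E.
rewrite big1 ?rmorph0 // => i _; rewrite /a; ring.
Qed.

End Dependence.

(** * Linear forms: primality and Koszul exactness *)

Section LinearForms.
Local Open Scope ring_scope.
Variables (k : closedFieldType) (n : nat).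
Local Notation R := {mpoly k[n.+1]}.
Implicit Types (a b c : 'rV[k]_n.+1) (p q : R).

Lemma mpoly_ring_ind (Q : R -> Prop) :
  (forall x : k, Q x%:MP) -> (forall i, Q 'X_i) ->
  (forall p q, Q p -> Q q -> Q (p + q)) ->
  (forall p q, Q p -> Q q -> Q (p * q)) -> forall p, Q p.
Proof.
move=> QC QX QD QM; elim/mpolyind => [|x m p _ _ Qp]; first by rewrite -mpolyC0.
apply: QD => //; rewrite -mul_mpolyC; apply: (QM) => //.
rewrite mpolyXE_id; apply: (big_ind Q) => //; first by rewrite -mpolyC1.
move=> i _; elim: (m i : nat) => [|e IHe]; first by rewrite expr0 -mpolyC1.
by rewrite exprS; apply: (QM).
Qed.

Lemma linear_form_is_linear : linear (@linear_form k n).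
Proof.
move=> x a b; rewrite /linear_form scaler_sumr -big_split /=.
by apply: eq_bigr => i _; rewrite !mxE scalerDl scalerA.
Qed.

HB.instance Definition _ := GRing.isLinear.Build k 'rV[k]_n.+1 R _
  (@linear_form k n) linear_form_is_linear.

Lemma linear_form_coeff a i : (linear_form a)@_U_(i) = a 0 i.
Proof.
rewrite /linear_form raddf_sum (bigD1 i) //= big1 => [|j ji].
  by rewrite mcoeffZ mcoeffXU eqxx mulr1 addr0.
by rewrite mcoeffZ mcoeffXU (negPf ji) mulr0.
Qed.

Lemma linear_form_eq0 a : (linear_form a == 0) = (a == 0).
Proof.
apply/eqP/eqP => [E|->]; last by rewrite raddf0.
by apply/rowP=> i; rewrite -linear_form_coeff E mcoeff0 mxE.
Qed.

Lemma linear_form_homog a : linear_form a \is 1.-homog.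
Proof. by apply: rpred_sum => i _; rewrite rpredZ // dhomogX /= mdeg1. Qed.

Lemma linear_form_delta i : linear_form (delta_mx 0 i) = 'X_i :> R.
Proof.
rewrite /linear_form (bigD1 i) //= big1 => [|j ji].
  by rewrite mxE !eqxx scale1r addr0.
by rewrite mxE (negPf ji) andbF scale0r.
Qed.

Lemma linear_form_coord a i :
  (forall j, j != i -> a 0 j = 0) -> linear_form a = a 0 i *: 'X_i.
Proof.
move=> H; rewrite /linear_form (bigD1 i) //= big1 ?addr0 // => j ji.
by rewrite H // scale0r.
Qed.

(* On the hyperplane l_a = 0 the variable x_i is solved for the other ones. *)
Definition elim_var a (i : 'I_n.+1) : R -> R :=
  comp_mpoly [tuple if j == i then 'X_j - (a 0 i)^-1 *: linear_form a
              else 'X_j | j < n.+1].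

HB.instance Definition _ a i := GRing.RMorphism.copy (elim_var a i)
  (comp_mpoly [tuple if j == i then 'X_j - (a 0 i)^-1 *: linear_form a
              else 'X_j | j < n.+1]).
HB.instance Definition _ a i := GRing.Linear.copy (elim_var a i)
  (comp_mpoly [tuple if j == i then 'X_j - (a 0 i)^-1 *: linear_form a
              else 'X_j | j < n.+1]).

Lemma elim_varX a i j : elim_var a i 'X_j =
  if j == i then 'X_j - (a 0 i)^-1 *: linear_form a else 'X_j.
Proof. by rewrite /elim_var comp_mpolyXU -tnth_nth tnth_mktuple. Qed.

Lemma elim_var_linear_form a i b :
  elim_var a i (linear_form b) = linear_form (b - (b 0 i / a 0 i) *: a).
Proof.
rewrite raddfB /= [linear_form (_ *: a)]linearZ /= {1 2}/linear_form.
rewrite raddf_sum /= (bigD1 i) //= [in RHS](bigD1 i) //= addrAC; congr (_ + _).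
  by rewrite linearZ /= elim_varX eqxx scalerBr scalerA.
by apply: eq_bigr => j ji; rewrite linearZ /= elim_varX (negPf ji).
Qed.

Lemma elim_var_mod a i p : dvdr (linear_form a) (p - elim_var a i p).
Proof.
elim/mpoly_ring_ind: p => [c|j|p q [u Eu] [v Ev]|p q [u Eu] [v Ev]].
- by exists 0; rewrite /elim_var comp_mpolyC subrr mulr0.
- rewrite elim_varX; case: eqP => _; last by exists 0; rewrite subrr mulr0.
  by exists ((a 0 i)^-1%:MP); rewrite mulrC mul_mpolyC opprB addrC subrK.
- by exists (u + v); rewrite raddfD /= mulrDr -Eu -Ev; ring.
exists (u * q + elim_var a i p * v).
by rewrite rmorphM /= mulrDr mulrA -Eu mulrCA -Ev; ring.
Qed.

Lemma elim_var_self a i : a 0 i != 0 -> elim_var a i (linear_form a) = 0.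
Proof.
by move=> nz; rewrite elim_var_linear_form divff // scale1r subrr raddf0.
Qed.

Lemma elim_var_eq0 a i p :
  a 0 i != 0 -> elim_var a i p = 0 <-> dvdr (linear_form a) p.
Proof.
move=> nz; split=> [E|[q ->]].
  by have := elim_var_mod a i p; rewrite E subr0.
by rewrite rmorphM /= elim_var_self // mul0r.
Qed.

(** By [elim_var_eq0] the ideal of the form is the kernel of a ring morphism into a domain. *)
Lemma linear_form_prime a p q : a != 0 -> dvdr (linear_form a) (p * q) ->
  dvdr (linear_form a) p \/ dvdr (linear_form a) q.
Proof.
case/rV0Pn=> i nz /(elim_var_eq0 _ nz)/eqP; rewrite rmorphM mulf_eq0.
by case/orP=> /eqP/(elim_var_eq0 _ nz); [left|right].
Qed.

Lemma dvdr_linear_form a b : a != 0 ->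
  dvdr (linear_form a) (linear_form b) -> exists x, b = x *: a.
Proof.
case/rV0Pn=> i nz /(elim_var_eq0 _ nz)/eqP.
rewrite elim_var_linear_form linear_form_eq0 subr_eq0 => /eqP E.
by exists (b 0 i / a 0 i).
Qed.

Lemma hyperplane_scale x a : x != 0 -> hyperplane (x *: a) = hyperplane a.
Proof.
move=> nz; apply/vspaceP=> v; rewrite !mem_hyperplane linearZ /= mevalZ.
by rewrite mulf_eq0 (negPf nz).
Qed.

Lemma linear_syzygy2 a b v w : a != 0 -> (forall x, b != x *: a) ->
  linear_form a * v + linear_form b * w = 0 ->
  exists z, v = linear_form b * z /\ w = - (linear_form a * z).
Proof.
move=> a0 indep E; have dw : dvdr (linear_form a) (linear_form b * w).
  by exists (- v); rewrite mulrN; apply/eqP; rewrite -addr_eq0 addrC E.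
have [/(dvdr_linear_form a0)[x Eb]|[q Ew]] := linear_form_prime a0 dw.
  by have := indep x; rewrite Eb eqxx.
have Ev : v = - (linear_form b * q).
  apply: (mulfI (x := linear_form a)); first by rewrite linear_form_eq0.
  by apply/eqP; rewrite -subr_eq0 -[X in _ == X]E Ew; apply/eqP; ring.
by exists (- q); rewrite Ev Ew; split; ring.
Qed.

(** Eliminating a variable on l_a = 0 leaves a relation between two nonproportional forms, solved by
    [linear_syzygy2]. The solution is lifted by [elim_var_mod], and u is recovered by cancelling
    l_a. *)
Lemma koszul_exact_linear a b c :
  (forall x y z, x *: a + y *: b + z *: c = 0 -> [/\ x = 0, y = 0 & z = 0]) ->
  koszul_exact (linear_form a) (linear_form b) (linear_form c).
Proof.
move=> indep u v w E.
have a0 : a != 0.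
  apply/eqP=> a0; case: (indep 1 0 0); last by move/eqP; rewrite oner_eq0.
  by rewrite a0 !scale0r scaler0 !addr0.
have [i nz] := rV0Pn _ a0.
pose b' := b - (b 0 i / a 0 i) *: a; pose c' := c - (c 0 i / a 0 i) *: a.
have b'0 : b' != 0.
  apply/eqP=> b'0; case: (indep (- (b 0 i / a 0 i)) 1 0).
    by rewrite scale0r addr0 scale1r scaleNr addrC.
  by move=> _ /eqP; rewrite oner_eq0.
have c'i x : c' != x *: b'.
  apply/eqP=> Ec.
  case: (indep (x * (b 0 i / a 0 i) - (c 0 i / a 0 i)) (- x) 1); last first.
    by move=> _ _ /eqP; rewrite oner_eq0.
  apply/rowP=> j; have /eqP := congr1 (fun d : 'rV_n.+1 => d 0 j) Ec.
  by rewrite -subr_eq0 !mxE => /eqP <-; ring.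
have := congr1 (elim_var a i) E.
rewrite !rmorphD !rmorphM rmorph0 /= elim_var_self // mul0r add0r.
rewrite !elim_var_linear_form => /(linear_syzygy2 b'0 c'i)[z [Ev Ew]].
have [v' /eqP] := elim_var_mod a i v; rewrite Ev subr_eq => /eqP {}Ev.
have [w' /eqP] := elim_var_mod a i w; rewrite Ew subr_eq => /eqP {}Ew.
have lb : linear_form b' = linear_form b - (b 0 i / a 0 i) *: linear_form a.
  by rewrite raddfB /= linearZ.
have lc : linear_form c' = linear_form c - (c 0 i / a 0 i) *: linear_form a.
  by rewrite raddfB /= linearZ.
rewrite -/b' -/c' lb lc -!mul_mpolyC in Ev Ew.
exists ((c 0 i / a 0 i)%:MP * z - v'), (- ((b 0 i / a 0 i)%:MP * z) - w'), z.
split; [|by rewrite Ev; ring|by rewrite Ew; ring].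
apply: (mulfI (x := linear_form a)); first by rewrite linear_form_eq0.
apply/eqP; rewrite -subr_eq0 -[X in _ == X]E Ev Ew; apply/eqP; ring.
Qed.

End LinearForms.

(** * Logarithmic derivations and hyperplane equations *)

Section LogDerivations.
Local Open Scope ring_scope.
Variables (k : closedFieldType) (n : nat).
Local Notation R := {mpoly k[n.+1]}.
Implicit Types (a b : 'rV[k]_n.+1) (p q : R) (theta : 'rV[R]_n.+1).
Implicit Types (A : arrangement k n).

Lemma derM theta p q : der theta (p * q) = der theta p * q + p * der theta q.
Proof. by case: (der_is_derivation theta). Qed.

Lemma der1 theta : der theta 1 = 0.
Proof. by rewrite /der big1 // => i _; rewrite -mpolyC1 mderivC mulr0. Qed.

Lemma der_linear_form theta a :
  der theta (linear_form a) = \sum_i a 0 i *: theta 0 i.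
Proof.
rewrite /linear_form; apply: (big_rec2 (fun p q => der theta p = q)).
  by rewrite /der big1 // => i _; rewrite raddf0 mulr0.
by move=> i q p _ <-; case: (der_is_derivation theta) => -> _; rewrite der_X.
Qed.

Lemma dvdr_linear_form_hyp A (t u : 'I_(nb_hyp A)) :
  dvdr (linear_form (hyp_form t)) (linear_form (hyp_form u)) -> t = u.
Proof.
case/(dvdr_linear_form (hyp_form_neq0 t)) => x E.
apply: hyp_form_distinct; rewrite E hyperplane_scale //.
by apply: contraNneq (hyp_form_neq0 u) => x0; rewrite E x0 scale0r.
Qed.

Lemma dvdr_linear_form_prod A t (r : seq 'I_(nb_hyp A)) :
  dvdr (linear_form (hyp_form t)) (\prod_(u <- r) linear_form (hyp_form u)) ->
  t \in r.
Proof.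
elim: r => [|u r IH]; rewrite ?big_nil ?big_cons.
  rewrite -[1]mpolyC1 => -[q E]; have [i nz] := rV0Pn _ (hyp_form_neq0 t).
  have := congr1 (elim_var (hyp_form t) i) E.
  rewrite rmorphM /= elim_var_self // mul0r mpolyC1 rmorph1 => /eqP.
  by rewrite oner_eq0.
rewrite inE; case/(linear_form_prime (hyp_form_neq0 t)).
  by move/dvdr_linear_form_hyp->; rewrite eqxx.
by move/IH->; rewrite orbT.
Qed.

(** The forms of distinct hyperplanes are pairwise nonassociated primes. *)
Lemma linear_form_prod_dvdr A (P : pred 'I_(nb_hyp A)) p :
  (forall t, P t -> dvdr (linear_form (hyp_form t)) p) ->
  dvdr (\prod_(t | P t) linear_form (hyp_form t)) p.
Proof.
move=> H; rewrite -big_filter; set r := filter _ _.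
have : forall t, t \in r -> dvdr (linear_form (hyp_form t)) p.
  by move=> t; rewrite mem_filter => /andP[/H].
have : uniq r by rewrite filter_uniq // index_enum_uniq.
elim: r => [|u r IH] /=; first by exists p; rewrite big_nil mul1r.
case/andP=> ur Ur Hr; have [|q Ep] := IH Ur.
  by move=> t tr; apply: Hr; rewrite inE tr orbT.
have := Hr u; rewrite inE eqxx Ep => /(_ isT).
case/(linear_form_prime (hyp_form_neq0 u)).
  by move/dvdr_linear_form_prod; rewrite (negPf ur).
by case=> q' ->; exists q'; rewrite big_cons mulrCA mulrA.
Qed.

(** By the Leibniz rule l_t divides theta(l_t) times the product of the other forms, none of which
    the prime l_t divides. Conversely, logarithmic derivatives add up. *)
Lemma log_derP A theta : log_der A theta <->
  forall t : 'I_(nb_hyp A),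
    dvdr (linear_form (hyp_form t)) (der theta (linear_form (hyp_form t))).
Proof.
split=> [[h E] t|H].
  rewrite /defining_poly (bigD1 t) //= derM in E.
  set g := \prod_(u | _) _ in E; set l := linear_form _ in E *.
  have : dvdr l (der theta l * g).
    by exists (h * g - der theta g); rewrite mulrBr mulrCA -E addrK.
  case/(linear_form_prime (hyp_form_neq0 t)) => //.
  rewrite /g -big_filter => /dvdr_linear_form_prod.
  by rewrite mem_filter eqxx.
rewrite /log_der /defining_poly.
apply: (big_ind (fun p => exists g, der theta p = g * p)) => [|p q|t _].
- by exists 0; rewrite der1 mul0r.
- by case=> g Eg [h Eh]; exists (g + h); rewrite derM Eg Eh; ring.
by have [q ->] := H t; exists q; rewrite mulrC.
Qed.

Definition coord_prod A (j : 'I_n.+1) : R :=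
  \prod_(t < nb_hyp A | hyp_form t 0 j != 0) linear_form (hyp_form t).

Definition coord_der A (j : 'I_n.+1) : 'rV[R]_n.+1 :=
  coord_prod A j *: delta_mx 0 j.

(** Forms without x_j are killed, and every other form is a factor of F_j. *)
Lemma log_der_coord A u j : log_der A (u *: coord_der A j).
Proof.
apply/log_derP=> t; rewrite der_linear_form (bigD1 j) //= big1 => [|i ij].
  rewrite addr0 !mxE !eqxx mulr1.
  have [->|nz] := eqVneq (hyp_form t 0 j) 0.
    by exists 0; rewrite scale0r mulr0.
  rewrite /coord_prod (bigD1 t) //= -mul_mpolyC.
  set l := linear_form _; set g := \prod_(_ | _) _.
  by exists ((hyp_form t 0 j)%:MP * u * g); ring.
by rewrite !mxE (negPf ij) andbF !mulr0 scaler0.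
Qed.

Lemma prod_linear_form_homog (I : finType) (P : pred I) (F : I -> 'rV[k]_n.+1) :
  \prod_(t | P t) linear_form (F t) \is #|P|.-homog.
Proof.
rewrite -sum1_card.
apply: (big_rec2 (fun p d => p \is d.-homog)); first exact: dhomog1.
by move=> t d p _ Hp; apply: dhomogM => //; apply: linear_form_homog.
Qed.

Lemma mem_hyperplane_sum a (v : 'rV[k]_n.+1) :
  (v \in hyperplane a) = (\sum_i a 0 i * v 0 i == 0).
Proof.
rewrite mem_hyperplane /linear_form raddf_sum; congr (_ == _).
by apply: eq_bigr => i _; rewrite /= mevalZ mevalXU.
Qed.

Lemma delta_hyperplane a i : (delta_mx 0 i \in hyperplane a) = (a 0 i == 0).
Proof.
rewrite mem_hyperplane_sum (bigD1 i) //= big1 => [|j ji].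
  by rewrite mxE !eqxx mulr1 addr0.
by rewrite mxE (negPf ji) andbF mulr0.
Qed.

Lemma coord_hyperplaneP a i : a != 0 ->
  hyperplane a = coord_hyperplane k i <-> forall j, j != i -> a 0 j = 0.
Proof.
move=> a0; split=> [E j ji|H].
  apply/eqP; rewrite -delta_hyperplane E mem_coord_hyperplane mxE.
  by rewrite [i == j]eq_sym (negPf ji) andbF.
have Ea : a = a 0 i *: delta_mx 0 i.
  apply/rowP=> j; rewrite !mxE; have [->|ji] := eqVneq j i.
    by rewrite mulr1.
  by rewrite mulr0 H.
rewrite Ea; apply: hyperplane_scale; apply: contraNneq a0 => a0.
by rewrite Ea a0 scale0r.
Qed.

Lemma coord_codim2P a i j :
  (coord_codim2 k i j <= hyperplane a)%VS <->
  forall l, l != i -> l != j -> a 0 l = 0.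
Proof.
split=> [/subvP H l li lj|H].
  apply/eqP; rewrite -delta_hyperplane; apply: H.
  by rewrite memv_cap !mem_coord_hyperplane !mxE [i == l]eq_sym [j == l]eq_sym
             (negPf li) (negPf lj) !andbF !eqxx.
apply/subvP=> v; rewrite memv_cap => /andP[].
rewrite 2!mem_coord_hyperplane => /eqP vi /eqP vj.
rewrite mem_hyperplane_sum big1 // => l _.
have [->|li] := eqVneq l i; first by rewrite vi mulr0.
have [->|lj] := eqVneq l j; first by rewrite vj mulr0.
by rewrite H ?mul0r.
Qed.

End LogDerivations.

(** * Consequences of generality *)

Section Hypertetrahedral.
Local Open Scope ring_scope.
Variables (k : closedFieldType) (n : nat) (A : arrangement k n).
Local Notation R := {mpoly k[n.+1]}.
Local Notation form t := (hyp_form (a := A) t).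
Implicit Types (i j l : 'I_n.+1) (t u w : 'I_(nb_hyp A)).

Lemma hyp_cap_dim t u : (n.+1 - 2 <= \dim (hyp t :&: hyp u))%N.
Proof.
have rk (f : 'Hom('rV[k]_n.+1, 'rV[k]_1)) (U : {vspace 'rV[k]_n.+1}) :
    (\dim U <= \dim (U :&: lker f) + 1)%N.
  rewrite -[X in (X <= _)%N](limg_ker_dim f U) leq_add2l.
  by rewrite (leq_trans (dimvS (subvf _))) // dimvf /dim /= muln1.
have := rk (linfun (mulmxr (form t)^T)) fullv.
have := rk (linfun (mulmxr (form u)^T)) (hyp t).
rewrite /hyp /hyperplane capfv dimvf /dim /= mul1n; lia.
Qed.

Lemma coord_formP (hc : complete A) i :
  exists2 t, form t 0 i != 0 & forall j, j != i -> form t 0 j = 0.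
Proof.
have [t Et] := hc i; have a0 := hyp_form_neq0 t; exists t.
  apply: contraNneq a0 => ai; apply/eqP/rowP=> j; rewrite mxE.
  have [->//|] := eqVneq j i.
  exact: (proj1 (coord_hyperplaneP i (hyp_form_neq0 t)) Et).
exact: (proj1 (coord_hyperplaneP i a0) Et).
Qed.

Lemma coord_form_uniq t u i :
  (forall j, j != i -> form t 0 j = 0) ->
  (forall j, j != i -> form u 0 j = 0) ->
  t = u.
Proof.
move=> /(coord_hyperplaneP _ (hyp_form_neq0 t)) Et.
move=> /(coord_hyperplaneP _ (hyp_form_neq0 u)) Eu.
by apply: hyp_form_distinct; rewrite Et Eu.
Qed.

Hypothesis hh : hypertetrahedral A.

Lemma hypertetrahedral_supp t i j l : i != j ->
  form t 0 i != 0 -> form t 0 j != 0 -> l != i -> l != j -> form t 0 l = 0.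
Proof.
move=> ij ai aj li lj; have [i' [j' [_ /coord_codim2P H]]] := hh t.
have mem m : form t 0 m != 0 -> (m == i') || (m == j').
  by apply: contraR; rewrite negb_or => /andP[? ?]; rewrite H.
apply/eqP/negPn/negP => /mem; move/mem: ai; move/mem: aj.
by do 3![case/orP=> /eqP ?]; subst; rewrite ?eqxx in ij li lj.
Qed.

Definition pair_prod i j : R :=
  \prod_(t | (form t 0 i != 0) && (form t 0 j != 0)) linear_form (form t).

Lemma pair_prodC i j : pair_prod i j = pair_prod j i.
Proof. by apply: eq_bigl => t; rewrite andbC. Qed.

Lemma pair_prod_neq0 i j : pair_prod i j != 0.
Proof. by apply/prodf_neq0 => t _; rewrite linear_form_eq0 hyp_form_neq0. Qed.

Hypothesis hg : general A.

(** If z is nonzero, the common zeros of [t] and [u] lie on [w], so three hyperplanes contain a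
    space of codimension at most 2; generality forbids this once the space has a point off the
    coordinate hyperplanes. *)
Lemma general_independent t u w i j l :
  i != j -> j != l -> l != i ->
  form t 0 i != 0 -> form t 0 j != 0 -> form u 0 j != 0 -> form u 0 l != 0 ->
  form w 0 l != 0 -> form w 0 i != 0 ->
  forall x y z, x *: form t + y *: form u + z *: form w = 0 ->
    [/\ x = 0, y = 0 & z = 0].
Proof.
move=> ij jl li ti tj uj ul wl wi x y z E.
have il : i != l by rewrite eq_sym.
have ji : j != i by rewrite eq_sym.
have lj : l != j by rewrite eq_sym.
have ts := @hypertetrahedral_supp t i j _ ij ti tj.
have us := @hypertetrahedral_supp u j l _ jl uj ul.
have ws := @hypertetrahedral_supp w l i _ li wl wi.
have Ec m : x * form t 0 m + y * form u 0 m + z * form w 0 m = 0.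
  by have := congr1 (fun v : 'rV_n.+1 => v 0 m) E; rewrite !mxE.
have [z0|z0] := eqVneq z 0.
  have := Ec i; rewrite z0 mul0r addr0 (us i) // mulr0 addr0 => /eqP.
  rewrite mulf_eq0 (negPf ti) orbF => /eqP x0.
  have := Ec j; rewrite z0 x0 !mul0r addr0 add0r => /eqP.
  by rewrite mulf_eq0 (negPf uj) orbF => /eqP.
have sumE (v : 'rV[k]_n.+1) : x * (\sum_m form t 0 m * v 0 m)
    + y * (\sum_m form u 0 m * v 0 m) + z * (\sum_m form w 0 m * v 0 m) = 0.
  rewrite !mulr_sumr -!big_split big1 //= => m _.
  by rewrite !mulrA -!mulrDl Ec mul0r.
have sub_w v : v \in hyp t -> v \in hyp u -> v \in hyp w.
  rewrite /hyp !mem_hyperplane_sum => /eqP Et /eqP Eu.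
  have /eqP := sumE v; rewrite Et Eu !mulr0 !add0r mulf_eq0 (negPf z0).
  exact: id.
pose B := [set t; u; w].
have tu : t != u by apply: contraNneq ti => ->; rewrite us.
have uw : u != w by apply: contraNneq uj => ->; rewrite ws.
have tw : t != w by apply: contraNneq tj => ->; rewrite ws.
have cB : #|B| = 3.
  by rewrite /B setUC cardsU1 !inE negb_or ![w == _]eq_sym tw uw cards2 tu.
(* With x_j = 1 the equations of [t] and [u] determine nonzero x_i and x_l; they do not involve the
   other coordinates, which are set to 1. *)
pose p : 'rV[k]_n.+1 := \row_m if m == i then - (form t 0 j / form t 0 i)
  else if m == l then - (form u 0 j / form u 0 l) else 1.
have pt : p \in hyp t.
  rewrite /hyp mem_hyperplane_sum (bigD1 i) //= (bigD1 j) //= big1 => [|m].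
    rewrite !mxE eqxx (negPf ji) (negPf jl) addr0 mulr1 mulrN mulrC divfK //.
    by rewrite addNr.
  by case/andP=> mi mj; rewrite ts ?mul0r.
have pu : p \in hyp u.
  rewrite /hyp mem_hyperplane_sum (bigD1 l) //= (bigD1 j) //= big1 => [|m].
    rewrite !mxE eqxx (negPf ji) (negPf jl) (negPf li) addr0 mulr1 mulrN.
    by rewrite mulrC divfK // addNr.
  by case/andP=> ml mj; rewrite us ?mul0r.
have memX v : v \in hyp t -> v \in hyp u -> v \in (\bigcap_(s in B) hyp s)%VS.
  move=> vt vu; rewrite memvE; apply/subv_bigcapP=> s.
  by rewrite !inE -memvE => /orP[/orP[]|] /eqP-> //; apply: sub_w.
set X := (\bigcap_(s in B) hyp s)%VS in memX.
have EX : proj_codim X = #|[set s : 'I_(nb_hyp A) | (X <= hyp s)%VS]|.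
  have := hg; rewrite /general => /(_ B) /=; rewrite -/X; apply.
  exists p; first exact: memX.
  move=> m; rewrite mem_coord_hyperplane mxE.
  have [_|_] := eqVneq m i; first by rewrite oppr_eq0 mulf_neq0 ?invr_neq0.
  have [_|_] := eqVneq m l; last by rewrite oner_neq0.
  by rewrite oppr_eq0 mulf_neq0 ?invr_neq0.
have : (#|B| <= proj_codim X)%N.
  rewrite EX; apply/subset_leq_card/subsetP=> s sB; rewrite inE.
  exact: bigcapv_inf sB (subvv _).
have XX : (hyp t :&: hyp u <= X)%VS.
  by apply/subvP=> v; rewrite memv_cap => /andP[]; apply: memX.
have := leq_trans (hyp_cap_dim t u) (dimvS XX); rewrite cB /proj_codim.
by move: (\dim X) => d; clear; lia.
Qed.

Lemma general_koszul_exact i j l : i != j -> j != l -> l != i ->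
  koszul_exact (pair_prod i j) (pair_prod j l) (pair_prod l i).
Proof.
move=> ij jl li; apply: koszul_exact_prod3 => t u w.
move=> /andP[ti tj] /andP[uj ul] /andP[wl wi].
apply: koszul_exact_linear; exact: (general_independent ij jl li).
Qed.

End Hypertetrahedral.

(** * Reduction modulo a set of variables *)

Section ZeroVars.
Local Open Scope ring_scope.
Variables (k : closedFieldType) (n : nat) (Z : {set 'I_n.+1}).
Local Notation R := {mpoly k[n.+1]}.

(** The quotient by the ideal (x_j, j in Z), realized as an endomorphism of R; membership in the
    ideal becomes vanishing, and primality holds because R is a domain. *)
Definition zero_vars : R -> R :=
  comp_mpoly [tuple if j \in Z then 0 else 'X_j | j < n.+1].

HB.instance Definition _ := GRing.RMorphism.copy zero_vars
  (comp_mpoly [tuple if j \in Z then 0 else 'X_j | j < n.+1]).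
HB.instance Definition _ := GRing.Linear.copy zero_vars
  (comp_mpoly [tuple if j \in Z then 0 else 'X_j | j < n.+1]).

Lemma zero_varsX j : zero_vars 'X_j = if j \in Z then 0 else 'X_j.
Proof. by rewrite /zero_vars comp_mpolyXU -tnth_nth tnth_mktuple. Qed.

Lemma zero_vars_linear_form (a : 'rV[k]_n.+1) :
  zero_vars (linear_form a) =
  linear_form (\row_j if j \in Z then 0 else a 0 j).
Proof.
rewrite /linear_form raddf_sum /=; apply: eq_bigr => j _.
by rewrite linearZ /= zero_varsX mxE; case: ifP; rewrite ?scaler0 ?scale0r.
Qed.

Lemma zero_vars_linear_form_neq0 (a : 'rV[k]_n.+1) j :
  j \notin Z -> a 0 j != 0 -> zero_vars (linear_form a) != 0.
Proof.
move=> /negPf jZ aj; rewrite zero_vars_linear_form linear_form_eq0.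
by apply: contraNneq aj => /rowP/(_ j); rewrite !mxE jZ => ->.
Qed.

Lemma zero_vars_linear_form_eq0 (a : 'rV[k]_n.+1) :
  (forall j, j \notin Z -> a 0 j = 0) -> zero_vars (linear_form a) = 0.
Proof.
move=> H; rewrite zero_vars_linear_form; apply/eqP; rewrite linear_form_eq0.
by apply/eqP/rowP=> j; rewrite !mxE; case: ifPn => // /H.
Qed.

Lemma zero_vars_homog d p : p \is d.-homog -> zero_vars p \is d.-homog.
Proof.
move=> /dhomogP Hp; rewrite [p]mpolyE raddf_sum big_seq; apply: rpred_sum.
move=> m /Hp Em /=; rewrite linearZ /= rpredZ // mpolyXE_id rmorph_prod /=.
have -> : d = mdeg m by rewrite -Em.
rewrite mdegE.
apply: (big_rec2 (fun q e => q \is e.-homog)); first exact: dhomog1.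
move=> i e q _ Hq; apply: dhomogM => //.
rewrite rmorphXn /= -[X in X.-homog]mul1n; apply: dhomogMn.
by rewrite zero_varsX; case: ifP => _; rewrite ?rpred0 // dhomogX /= mdeg1.
Qed.

Lemma pihomog_zero_vars d p :
  pihomog mdeg d (zero_vars p) = zero_vars (pihomog mdeg d p).
Proof.
elim/mpolyind: p => [|c m p _ _ IHp]; first by rewrite !raddf0.
rewrite !raddfD /= IHp; congr (_ + _).
rewrite !linearZ /=; congr (_ *: _); rewrite pihomogX.
have hm : zero_vars 'X_[m] \is (mdeg m).-homog.
  by apply: zero_vars_homog; rewrite dhomogX.
case: eqP => [<-|/eqP md]; first by rewrite pihomog_dE.
by rewrite raddf0 (pihomog_ne0 md hm).
Qed.

Lemma zero_vars_proj_point j : j \notin Z ->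
  proj_point (fun p => zero_vars p = 0).
Proof.
move=> jZ; split=> [|p q Ep Eq|p q Eq|p q|p d Ep|].
- exact: rmorph0.
- by rewrite rmorphD /= Ep Eq addr0.
- by rewrite rmorphM /= Eq mulr0.
- by move/eqP; rewrite rmorphM mulf_eq0 => /orP[]/eqP; [left|right].
- by rewrite -pihomog_zero_vars Ep raddf0.
exists j; rewrite zero_varsX (negPf jZ) => /(congr1 (mcoeff U_(j)%MM)).
by rewrite mcoeffXU eqxx mcoeff0 => /eqP; rewrite oner_eq0.
Qed.

End ZeroVars.

(** * Independence of the coordinate derivations modulo the prime *)

Section MinimalGenerators.
Local Open Scope ring_scope.
Variables (k : closedFieldType) (n : nat) (A : arrangement k n).
Local Notation R := {mpoly k[n.+1]}.
Local Notation form t := (hyp_form (a := A) t).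
Hypotheses (hh : hypertetrahedral A) (hc : complete A) (hg : general A).
Hypothesis hs : forall i j : 'I_n.+1, i != j ->
  exists t : 'I_(nb_hyp A), (form t 0 i != 0) && (form t 0 j != 0).

(** The equation of x_i = 0 gives theta_i = x_i V_i. For a form l = a x_i + b x_j with a, b nonzero,
    theta(l) = a x_i (V_i - V_j) + l V_j; hence l divides x_i (V_i - V_j), and it does not divide
    x_i. *)
Lemma log_der_coords theta : log_der A theta ->
  exists V : 'I_n.+1 -> R, (forall i, theta 0 i = 'X_i * V i) /\
    forall i j, i != j -> dvdr (pair_prod A i j) (V i - V j).
Proof.
move/log_derP=> H.
have dX i : dvdr 'X_i (theta 0 i).
  have [t ti tj] := coord_formP hc i; have [q] := H t.
  rewrite der_linear_form (bigD1 i) //= big1 => [|j ji]; last first.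
    by rewrite tj ?scale0r.
  rewrite (linear_form_coord tj) addr0 -scalerAl => E; exists q.
  exact: scalerI E.
have [V EV] := fin_all_exists dX; exists V; split=> // i j ij.
apply: linear_form_prod_dvdr => t /andP[ti tj].
have ts l : l != i -> l != j -> form t 0 l = 0.
  exact: (hypertetrahedral_supp hh ij ti tj).
have El : linear_form (form t) = form t 0 i *: 'X_i + form t 0 j *: 'X_j.
  rewrite /linear_form (bigD1 i) //= (bigD1 j) 1?eq_sym //= big1 ?addr0 //.
  by move=> l /andP[li lj]; rewrite ts ?scale0r.
have : dvdr (linear_form (form t)) ('X_i * (V i - V j)).
  have [q] := H t; rewrite der_linear_form (bigD1 i) //= (bigD1 j) 1?eq_sym //=.
  rewrite big1 ?addr0 => [|l /andP[li lj]]; last by rewrite ts ?scale0r.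
  rewrite !EV El -!mul_mpolyC => E.
  exists ((form t 0 i)^-1%:MP * (q - V j)); apply: (scalerI ti).
  rewrite -!mul_mpolyC; set x := (form t 0 i)%:MP in E *.
  have xV : x * (form t 0 i)^-1%:MP = 1 by rewrite -mpolyCM divff // mpolyC1.
  transitivity ((x * (form t 0 i)^-1%:MP) *
      ((x * 'X_i + (form t 0 j)%:MP * 'X_j) * (q - V j))); last by ring.
  by rewrite xV mul1r [RHS]mulrBr -E; ring.
case/(linear_form_prime (hyp_form_neq0 t)) => // -[q E].
have := congr1 (mcoeff U_(j)%MM) E.
have [x Ex] : exists x, delta_mx 0 i = x *: form t.
  apply: dvdr_linear_form; first exact: hyp_form_neq0.
  by exists q; rewrite linear_form_delta.
have /eqP := congr1 (fun v : 'rV_n.+1 => v 0 j) Ex.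
rewrite !mxE [j == i]eq_sym (negPf ij) andbF eq_sym mulf_eq0 (negPf tj) orbF.
move/eqP=> x0; have /eqP := congr1 (fun v : 'rV_n.+1 => v 0 i) Ex.
by rewrite !mxE !eqxx x0 mul0r oner_eq0.
Qed.

(** [G] collects the forms joining x_i to a variable outside x_i, x_j, x_l, which survive the
    reduction; [x] is the scalar in the chosen equation of x_i = 0. *)
Lemma coord_prod_factor i j l : i != j -> j != l -> l != i ->
  exists (x : k) (G : R), [/\ x != 0, zero_vars [set i; j; l] G != 0 &
    coord_prod A i = 'X_i * (pair_prod A i j * pair_prod A l i * (x *: G))].
Proof.
move=> ij jl li; have [t ti ts] := coord_formP hc i.
rewrite /coord_prod (bigD1 t) //= (bigID (fun u => form u 0 j != 0)) /=.
rewrite [X in _ * (_ * X)](bigID (fun u => form u 0 l != 0)) /=.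
rewrite (linear_form_coord ts).
set G := \prod_(u | _ && ~~ (form u 0 l != 0)) _.
exists (form t 0 i), G; split=> //.
  rewrite rmorph_prod; apply/prodf_neq0 => u /andP[/andP[/andP[ui ut] uj] ul].
  have [m /andP[mi um]|H] := pickP (fun m => (m != i) && (form u 0 m != 0)).
    apply: (zero_vars_linear_form_neq0 (j := m)) => //.
    rewrite !inE (negPf mi) /=; apply/norP.
    by split; apply: contraTneq um => ->.
  case/eqP: ut; apply: (coord_form_uniq (i := i)) => // m mi.
  by have := H m; rewrite mi => /negbFE/eqP.
rewrite -scalerAl -!scalerAr; congr (_ *: ('X_i * _)).
rewrite mulrA; congr (_ * _ * _); apply: eq_bigl => u.
  case uj: (form u 0 j != 0); rewrite ?andbF // !andbT.
  rewrite andb_idr // => _; apply: contraTneq uj => ->.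
  by rewrite ts ?eqxx // eq_sym.
rewrite [RHS]andbC; case ul: (form u 0 l != 0); rewrite ?andbF // !andbT.
case ui: (form u 0 i != 0) => //=.
have -> : form u 0 j = 0.
  by apply: (hypertetrahedral_supp hh _ ul ui); rewrite // eq_sym.
rewrite eqxx andbT; by apply: contraTneq ul => ->; rewrite ts ?eqxx.
Qed.

(** By [hs] the product has at least one factor, a form in x_i and x_j alone. *)
Lemma zero_vars_pair_prod (Z : {set 'I_n.+1}) i j :
  i != j -> i \in Z -> j \in Z -> zero_vars Z (pair_prod A i j) = 0.
Proof.
move=> ij iZ jZ; have [t /andP[ti tj]] := hs ij.
rewrite /pair_prod (bigD1 t) ?ti ?tj //= rmorphM /=.
rewrite zero_vars_linear_form_eq0 ?mul0r // => l lZ.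
by apply: (hypertetrahedral_supp hh ij ti tj); apply: contraNneq lZ => ->.
Qed.

(** The cyclic differences of V_i, V_j, V_l sum to 0, so their quotients by the pair products form a
    syzygy, and exactness rewrites the first quotient. *)
Lemma pair_prod_difference i j l (r : nat)
    (V : 'I_r -> 'I_n.+1 -> R) (p : 'I_r -> R) (rho : {rmorphism R -> R}) :
  i != j -> j != l -> l != i ->
  (forall s i j, i != j -> dvdr (pair_prod A i j) (V s i - V s j)) ->
  (forall s, rho (p s) = 0) ->
  exists g h, [/\ rho g = 0, rho h = 0 &
    \sum_s p s * V s i - \sum_s p s * V s j =
    pair_prod A i j * (pair_prod A j l * g + pair_prod A l i * h)].
Proof.
move=> ij jl li HV Hp.
have step s : exists gh : R * R, V s i - V s j =
    pair_prod A i j * (pair_prod A j l * gh.1 + pair_prod A l i * gh.2).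
  have [u Eu] := HV s i j ij; have [w Ew] := HV s j l jl.
  have [z Ez] := HV s l i li.
  have [|g [h [_ [Eg _ _]]]] := general_koszul_exact hh hg ij jl li (u := u)
    (v := w) (w := z); first by rewrite -Eu -Ew -Ez; ring.
  by exists (g, h); rewrite Eu Eg.
have [gh Egh] := fin_all_exists step.
exists (\sum_s p s * (gh s).1), (\sum_s p s * (gh s).2); split.
- by rewrite rmorph_sum big1 // => s _; rewrite rmorphM /= Hp mul0r.
- by rewrite rmorph_sum big1 // => s _; rewrite rmorphM /= Hp mul0r.
rewrite -sumrB !mulr_sumr -big_split mulr_sumr /=; apply: eq_bigr => s _.
by rewrite -mulrBr Egh; ring.
Qed.

(* By Nakayama, at least n + 1 generators are needed at (x_i, x_j, x_l). *)
Lemma coord_der_minimal i j l (r : nat) (v : 'I_r -> 'rV[R]_n.+1)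
    (p : 'I_r -> R) (lam : 'I_n.+1 -> R) (b : R) :
  let Z := [set i; j; l] in
  i != j -> j != l -> l != i ->
  (forall s, log_der A (v s)) -> (forall s, zero_vars Z (p s) = 0) ->
  \sum_m lam m *: coord_der A m = \sum_s p s *: v s + b *: euler k n ->
  forall m, zero_vars Z (lam m) = 0.
Proof.
move=> Z ij jl li Hv Hp E.
have [V HV] := fin_all_exists (fun s => log_der_coords (Hv s)).
(* [B m] is coordinate m of the right-hand side divided by x_m; the Euler term contributes the same
   [b] to each and cancels in differences. *)
pose B m := \sum_s p s * V s m + b.
have EB m : lam m * coord_prod A m = 'X_m * B m.
  have := congr1 (fun w : 'rV_n.+1 => w 0 m) E.
  rewrite !mxE !summxE (bigD1 m) //= big1 => [|m' mm'].
    rewrite !mxE !eqxx mulr1 addr0 => ->; rewrite /B mulrDr mulr_sumr.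
    rewrite [b * _]mulrC; congr (_ + _); apply: eq_bigr => s _.
    by rewrite mxE (proj1 (HV s)) mulrCA.
  by rewrite !mxE [m == m']eq_sym (negPf mm') andbF !mulr0.
have X0 m : 'X_m != 0 :> R.
  by rewrite -linear_form_delta linear_form_eq0; apply/eqP=> /rowP/(_ m)/eqP;
     rewrite !mxE !eqxx oner_eq0.
have core i' j' l' : i' != j' -> j' != l' -> l' != i' ->
    [set i'; j'; l'] = Z -> zero_vars Z (lam i') = 0 /\ zero_vars Z (B i') = 0.
  move=> ij' jl' li' EZ.
  have ji' : j' != i' by rewrite eq_sym.
  have lj' : l' != j' by rewrite eq_sym.
  have il' : i' != l' by rewrite eq_sym.
  have P0 i1 j1 : i1 != j1 -> i1 \in Z -> j1 \in Z ->
    zero_vars Z (pair_prod A i1 j1) = 0 by exact: zero_vars_pair_prod.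
  have iZ : i' \in Z by rewrite -EZ !inE eqxx.
  have jZ : j' \in Z by rewrite -EZ !inE eqxx orbT.
  have lZ : l' \in Z by rewrite -EZ !inE eqxx !orbT.
  have [x [G [x0 G0 EG]]] := coord_prod_factor ij' jl' li'.
  have [y [H [y0 _ EH]]] := coord_prod_factor ji' il' lj'.
  rewrite EZ in G0.
  have [g [h [g0 h0 Egh]]] := pair_prod_difference (rho := zero_vars Z)
    ij' jl' li' (fun s => proj2 (HV s)) Hp.
  have Bi : B i' = lam i' * (pair_prod A i' j' * pair_prod A l' i' * (x *: G)).
    by apply: (mulfI (X0 i')); rewrite -EB EG; ring.
  have Bj : B j' = lam j' * (pair_prod A i' j' * pair_prod A j' l' * (y *: H)).
    apply: (mulfI (X0 j')); rewrite -EB EH (pair_prodC _ j' i').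
    by rewrite (pair_prodC _ l' j'); ring.
  split; last by rewrite Bi !rmorphM /= P0 // !(mul0r, mulr0).
  (* Two expressions of B_i' - B_j', after cancelling P_i'j', give a syzygy with first entry 0.
     Exactness puts its last entry in the ideal of the pair products, hence in the kernel. *)
  have [|g' [h' [l0 [_ _ Ew]]]] := general_koszul_exact hh hg ij' jl' li'
    (u := 0) (v := - (lam j' * (y *: H) + g)) (w := lam i' * (x *: G) - h).
    apply: (mulfI (pair_prod_neq0 A i' j')).
    have : B i' - B j' = \sum_s p s * V s i' - \sum_s p s * V s j'.
      by rewrite /B; ring.
    rewrite Egh Bi Bj => /eqP; rewrite -subr_eq0 => /eqP EQ.
    by rewrite [RHS]mulr0 -[RHS]EQ; ring.
  have := congr1 (zero_vars Z) Ew.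
  rewrite !rmorphB rmorphN !rmorphM /= linearZ /= h0 !P0 // !mul0r !subr0 oppr0.
  by move/eqP; rewrite mulf_eq0 scaler_eq0 (negPf x0) (negPf G0) !orbF => /eqP.
have EZ1 : [set j; l; i] = Z by apply/setP=> m; rewrite !inE; do ?case: eqP.
have EZ2 : [set l; i; j] = Z by apply/setP=> m; rewrite !inE; do ?case: eqP.
have [li0 Bi0] := core i j l ij jl li erefl.
have [lj0 _] := core j l i jl li ij EZ1.
have [ll0 _] := core l i j li ij jl EZ2.
(* All [B m] reduce to [b], so the vanishing of one of them kills all. *)
have rhoB m : zero_vars Z (B m) = zero_vars Z b.
  rewrite /B rmorphD rmorph_sum big1 ?add0r // => s _.
  by rewrite rmorphM /= Hp mul0r.
move=> m; have [mZ|mZ] := boolP (m \in Z).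
  by move: mZ; rewrite !inE => /orP[/orP[]|] /eqP->.
(* For m outside Z every factor of F_m contains x_m and survives the reduction. *)
have := congr1 (zero_vars Z) (EB m).
rewrite !rmorphM /= rhoB -(rhoB i) Bi0 mulr0 => /eqP; rewrite mulf_eq0.
case/orP=> /eqP // /eqP; rewrite rmorph_prod => /prodf_eq0[t tm].
by rewrite (negPf (zero_vars_linear_form_neq0 mZ tm)).
Qed.

End MinimalGenerators.

(** * Numerators of linear combinations of fractions *)

Section FractionNumerators.
Local Open Scope ring_scope.
Variables (R : comNzRingType) (f : R) (V : lmodType R).
Variables (r : nat) (c : 'I_r -> R * nat) (e : 'I_r -> V * nat).

(** [frac_add] multiplies denominators even when they agree; cross-multiplication recovers the plain
    sum of numerators over f^B. *)
Lemma frac_lincomb_common_exponent B :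
  (forall l, (c l).2 + (e l).2 = B)%N ->
  f ^+ B *: (frac_lincomb f c e).1 =
  f ^+ (frac_lincomb f c e).2 *: \sum_l (c l).1 *: (e l).1.
Proof.
move=> HB; rewrite /frac_lincomb.
apply: (big_rec2 (fun x s => f ^+ B *: x.1 = f ^+ x.2 *: s)).
  by rewrite !scaler0.
move=> l s x _ E /=; rewrite HB !scalerDr.
by congr (_ + _); rewrite ?E scalerA -exprD.
Qed.

Lemma frac_lincomb_numerator :
  exists g : 'I_r -> R, (frac_lincomb f c e).1 = \sum_l g l *: (e l).1.
Proof.
pose T (x : V) := exists g : 'I_r -> R, x = \sum_l g l *: (e l).1.
rewrite /frac_lincomb -/(T _).
apply: (big_ind (fun x : V * nat => T x.1)).
- by exists (fun=> 0); rewrite big1 // => l _; rewrite scale0r.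
- move=> [x a] [y b] /= [g ->] [h ->].
  exists (fun l => f ^+ b * g l + f ^+ a * h l).
  rewrite !scaler_sumr -big_split; apply: eq_bigr => l _ /=.
  by rewrite scalerDl !scalerA.
move=> l _; exists (fun l' => if l' == l then (c l).1 else 0).
rewrite (bigD1 l) //= eqxx big1 ?addr0 // => l' /negPf ->; exact: scale0r.
Qed.

End FractionNumerators.

(** * Upper bound for the rank *)

Section Rank.
Local Open Scope ring_scope.
Variables (k : closedFieldType) (n : nat).
Local Notation R := {mpoly k[n.+1]}.

Lemma pihomog_mulr (p q : R) d e :
  q \is e.-homog -> pihomog mdeg (d + e) (p * q) = pihomog mdeg d p * q.
Proof.
move=> Hq; elim/mpolyind: p => [|x m p _ _ IHp].
  by rewrite raddf0 mul0r raddf0.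
rewrite mulrDl !raddfD /= mulrDl IHp; congr (_ + _).
rewrite -scalerAl !linearZ /= -scalerAl; congr (_ *: _).
have Hm : 'X_[m] * q \is (mdeg m + e).-homog.
  by apply: dhomogM => //; rewrite dhomogX.
rewrite pihomogX; case: eqP => [<-|/eqP md]; first by rewrite pihomog_dE.
by rewrite mul0r (pihomog_ne0 _ Hm) // eqn_add2r.
Qed.

Lemma pihomog_neq0 (p : R) : p != 0 -> exists d, pihomog mdeg d p != 0.
Proof.
move=> p0; have [d /eqP Hd|H] := pickP (fun d : 'I_(mmeasure mdeg p) =>
  pihomog mdeg d p != 0); first by exists d; apply/eqP.
case/eqP: p0; rewrite (@pihomog_partitionE _ _ mdeg _ p (leqnn _)).
by rewrite big1 // => d _; apply/eqP/negbFE/H.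
Qed.

Lemma mpolyX_neq0 (m : 'X_{1..n.+1}) : 'X_[m] != 0 :> R.
Proof.
apply/eqP=> /(congr1 (mcoeff m))/eqP.
by rewrite mcoeffX eqxx mcoeff0 oner_eq0.
Qed.

(** For r > n the numerators of the e_l and the Euler derivation are more than n + 1 vectors of
    R^(n+1). A homogeneous component of their relation, shifted by a power of x_0, gives degree 0
    fractions violating independence. *)
Lemma homog_independent_rank (d : nat) (f : R) (r : nat)
    (e : 'I_r -> 'rV[R]_n.+1 * nat) : (0 < d)%N -> f != 0 ->
  (forall l, der_homog ((e l).2 * d) (e l).1) ->
  (forall c : 'I_r -> R * nat, (forall l, fun_frac d (c l)) ->
     frac_eq f (@euler_multiple k n) (frac_lincomb f c e) (0, 0%N) ->
     forall l, frac_eq f (V := R^o) (fun g => g = 0) (c l) (0, 0%N)) ->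
  (r <= n)%N.
Proof.
move=> d_gt0 f0 He indep; rewrite leqNgt; apply/negP=> lt_nr.
(* Row 0 is the Euler derivation. *)
pose C (i : 'I_r.+1) (j : 'I_n.+1) : R :=
  if unlift ord0 i is Some l then (e l).1 0 j else 'X_j.
have [mu [i0 mu0] Emu] := left_dependence
  (idfun : {rmorphism R -> R}) C lt_nr.
pose lam l := mu (lift ord0 l).
have {}Emu j : mu ord0 * 'X_j + \sum_l lam l * (e l).1 0 j = 0.
  rewrite -[RHS](Emu j) /= big_ord_recl /C unlift_none; congr (_ + _).
  by apply: eq_bigr => l _; rewrite liftK.
have [l0 lam0] : exists l0, lam l0 != 0.
  have [l /= H|H] := pickP (fun l => lam l != 0); first by exists l.
  have := Emu ord0; rewrite big1 ?addr0 => [/eqP|l _]; last first.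
    by have /negbFE/eqP-> := H l; rewrite mul0r.
  rewrite mulf_eq0 (negPf (mpolyX_neq0 _)) orbF => /eqP mu00.
  move: mu0; have [l ->|->] := unliftP ord0 i0; last by rewrite /= mu00 eqxx.
  by have /negbFE := H l; rewrite /lam /= => ->.
have [D HD] := pihomog_neq0 lam0.
(* This common exponent leaves room to raise degree D to (B - (e l0).2) d by a power of x_0, so that
   the nonzero component of [lam l0] is the one selected. *)
pose B := (D + \sum_l (e l).2)%N.
have leB l : ((e l).2 + D <= B)%N.
  by rewrite /B addnC leq_add2l (bigD1 l) //= leq_addr.
pose N := (B * d - (e l0).2 * d - D)%N.
have EN : (D + N = (B - (e l0).2) * d)%N.
  have := leB l0; rewrite /N mulnBl => H.
  have : (D <= (B - (e l0).2) * d)%N by rewrite -[D]muln1 leq_mul //; lia.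
  by rewrite mulnBl; lia.
pose Y : R := 'X_ord0 ^+ N.
have HY : Y \is N.-homog.
  rewrite /Y -[X in X.-homog]mul1n; apply: dhomogMn.
  by rewrite dhomogX /= mdeg1.
pose c l := (pihomog mdeg ((B - (e l).2) * d) (lam l * Y), (B - (e l).2)%N).
have sum_c : \sum_l (c l).1 *: (e l).1 =
    - pihomog mdeg (B * d) (mu ord0 * Y) *: euler k n.
  apply/rowP=> j; rewrite summxE !mxE mulNr; apply/eqP; rewrite -addr_eq0.
  have HX : ('X_j : R) \is 1.-homog by rewrite dhomogX /= mdeg1.
  rewrite -(pihomog_mulr _ _ HX).
  have -> : \sum_l ((c l).1 *: (e l).1) 0 j =
      pihomog mdeg (B * d + 1) (\sum_l lam l * Y * (e l).1 0 j).
    rewrite raddf_sum; apply: eq_bigr => l _; rewrite mxE /=.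
    rewrite -(pihomog_mulr _ _ (He l j)); congr (pihomog _ _ _).
    by rewrite addnS -mulnDl subnK ?addn1 //; have := leB l; lia.
  rewrite -raddfD /= -[X in _ == X](raddf0 (pihomog mdeg (B * d + 1))).
  apply/eqP; congr pihomog.
  transitivity (Y * (mu ord0 * 'X_j + \sum_l lam l * (e l).1 0 j)); last first.
    by rewrite Emu mulr0.
  rewrite mulrDr mulr_sumr addrC; congr (_ + _); first by ring.
  by apply: eq_bigr => l _; ring.
have [||w] := indep c _ _ l0.
- by move=> l; apply: pihomogP.
- exists B; rewrite expr0 scale1r scaler0 subr0.
  rewrite (frac_lincomb_common_exponent _ (B := B)) => [|l].
    rewrite sum_c scalerA; eexists; reflexivity.
  by rewrite /c /= subnK //; have := leB l; lia.
rewrite expr0 scale1r scaler0 subr0 => /eqP.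
rewrite [_ *: _]/(_ * _) mulf_eq0 expf_eq0 (negPf f0) andbF /= -EN.
rewrite (pihomog_mulr _ _ HY) mulf_eq0 (negPf HD) expf_eq0.
by rewrite (negPf (mpolyX_neq0 _)) andbF.
Qed.

End Rank.

(** * Generators near the chosen point *)

Section Stalk.
Local Open Scope ring_scope.
Variables (k : closedFieldType) (n : nat) (A : arrangement k n).
Local Notation R := {mpoly k[n.+1]}.

(** Among the hyperplanes through x_i = x_j = 0, only the two coordinate ones have an equation
    lacking x_i or x_j. *)
Lemma exists_noncoord_form (i j : 'I_n.+1) : complete A -> i != j ->
  (2 < #|[set t : 'I_(nb_hyp A) | (coord_codim2 k i j <= hyp t)%VS]|)%N ->
  exists t : 'I_(nb_hyp A), (hyp_form t 0 i != 0) && (hyp_form t 0 j != 0).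
Proof.
move=> hc ij; set S := [set t | _] => S2.
have [t _ ti] := coord_formP hc i; have [u _ uj] := coord_formP hc j.
have [w wS] : exists2 w, w \in S & w \notin [set t; u].
  apply/subsetPn; apply: contraL S2 => /subset_leq_card H.
  by rewrite -leqNgt (leq_trans H) // cards2; case: (_ != _).
rewrite inE in wS; have {}wS := proj1 (coord_codim2P _ i j) wS.
rewrite !inE => /norP[wt wu]; exists w; apply/andP; split.
  apply: contraNneq wu => wi; apply/eqP/(coord_form_uniq (i := j)) => // m mj.
  by have [->|mi] := eqVneq m i; [|apply: wS].
apply: contraNneq wt => wj; apply/eqP/(coord_form_uniq (i := i)) => // m mi.
by have [->|mj] := eqVneq m j; [|apply: wS].
Qed.

(** A power of x_h, which [rho] does not kill, brings F_m d/dx_m to a degree divisible by d;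
    clearing denominators in its expansion gives the factor [z.1.1]. *)
Lemma coord_der_span (rho : {rmorphism R -> R}) (h m : 'I_n.+1) (d : nat)
    (f : R) (r : nat) (e : 'I_r -> 'rV[R]_n.+1 * nat) :
  (0 < d)%N -> rho f != 0 -> rho 'X_h != 0 ->
  (forall x, log_frac A d x -> exists2 c : 'I_r -> R * nat,
     forall l, fun_frac d (c l) &
     frac_eq f (@euler_multiple k n) x (frac_lincomb f c e)) ->
  exists z : R * ('I_r -> R) * R, rho z.1.1 != 0 /\
    z.1.1 *: coord_der A m = \sum_l z.1.2 l *: (e l).1 + z.2 *: euler k n.
Proof.
move=> d_gt0 f0 h0 Hspan.
pose w := #|[pred t : 'I_(nb_hyp A) | hyp_form t 0 m != 0]|.
have Ha : coord_prod A m \is w.-homog by apply: prod_linear_form_homog.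
(* The nonzero entry has degree w, and exponent w of f requires degree w d + 1. *)
pose N := (w * d + 1 - w)%N.
have EN : (N + w = (w * d).+1)%N.
  have : (w <= w * d)%N by rewrite leq_pmulr.
  by rewrite /N; lia.
have HY : ('X_h ^+ N : R) \is N.-homog.
  by rewrite -[X in X.-homog]mul1n; apply: dhomogMn; rewrite dhomogX /= mdeg1.
have [|c _ [b]] := Hspan ('X_h ^+ N *: coord_der A m, w).
  split; first exact: log_der_coord.
  move=> j; rewrite /= !mxE -EN eqxx /=.
  case: (j == m); last by rewrite !mulr0 rpred0.
  by rewrite mulr1; apply: dhomogM.
have [g Eg] := frac_lincomb_numerator f c e.
set y := frac_lincomb f c e in Eg *; rewrite /= Eg scalerBr => -[q /eqP].
rewrite subr_eq => /eqP E.
exists (f ^+ (b + y.2) * 'X_h ^+ N, fun l => f ^+ (b + w) * g l, q); split=> /=.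
  by rewrite rmorphM !rmorphXn mulf_neq0 ?expf_neq0.
rewrite exprD -!scalerA E addrC; congr (_ + _).
rewrite scalerA -exprD scaler_sumr.
by apply: eq_bigr => l _; rewrite scalerA.
Qed.

End Stalk.

(** * Contradiction at the generic point of x_0 = x_1 = x_2 = 0 *)

Theorem proposition3p12 (k : closedFieldType) (char0 : [pchar k]%R =i pred0)
    (n : nat) (n_ge3 : 3 <= n)
    (s : 'I_n.+1 -> 'I_n.+1 -> nat)
    (s_ge1 : forall i j : 'I_n.+1, i < j -> 1 <= s i j)
    (A : arrangement k n) (A_in_calH : in_calH s A) :
  general A -> ~ locally_free A.
Proof.
move=> hg; case: A_in_calH => hh hc hcard hlf.
have hs (i j : 'I_n.+1) : i != j -> exists t : 'I_(nb_hyp A),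
    (hyp_form t 0%R i != 0%R) && (hyp_form t 0%R j != 0%R).
  have lt_hs (i' j' : 'I_n.+1) : i' < j' -> exists t : 'I_(nb_hyp A),
      (hyp_form t 0%R i' != 0%R) && (hyp_form t 0%R j' != 0%R).
    move=> lt_ij; apply: exists_noncoord_form => //.
      by rewrite neq_ltn lt_ij.
    by rewrite hcard // addn2 !ltnS s_ge1.
  rewrite neq_ltn => /orP[/lt_hs //|/lt_hs[t Ht]].
  by exists t; rewrite andbC.
have [lt0 lt1 lt2] : [/\ 0 < n.+1, 1 < n.+1 & 2 < n.+1] by split; lia.
pose i : 'I_n.+1 := Ordinal lt0; pose j : 'I_n.+1 := Ordinal lt1.
(* The fourth index [h] provides a variable outside the prime. *)
pose l : 'I_n.+1 := Ordinal lt2; pose h : 'I_n.+1 := Ordinal (n_ge3 : 3 < n.+1).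
pose Z := [set i; j; l].
pose rho : {rmorphism {mpoly k[n.+1]} -> {mpoly k[n.+1]}} := zero_vars Z.
have hZ : h \notin Z by rewrite !inE.
have [d [f [d_gt0 _ /eqP f0 [r [e [He Hspan Hind]]]]]] :=
  hlf _ (zero_vars_proj_point k hZ).
have le_rn : r <= n.
  apply: (homog_independent_rank d_gt0 _ (fun m => proj2 (He m)) Hind).
  by apply: contraNneq f0 => ->; rewrite rmorph0.
have h0 : rho 'X_h != 0%R by rewrite /rho /= zero_varsX (negPf hZ) mpolyX_neq0.
have [z Hz] := fin_all_exists (fun m => coord_der_span m d_gt0
  (f0 : rho f != 0%R) h0 Hspan).
(* As r < n + 1, some combination of the expansions has all its coefficients at the basis elements
   in the kernel of [rho]. *)
have [lam [m0 lam0] Elam] := left_dependence rho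
  (fun m q => (z m).1.2 q) (le_rn : r < n.+1).
have := coord_der_minimal hh hc hg hs (i := i) (j := j) (l := l)
  (v := fun q => (e q).1) (p := fun q => (\sum_m lam m * (z m).1.2 q)%R)
  (lam := fun m => (lam m * (z m).1.1)%R) (b := (\sum_m lam m * (z m).2)%R).
move=> /(_ isT isT isT (fun q => proj1 (He q)) Elam).
have E : (\sum_m (lam m * (z m).1.1) *: coord_der A m =
   \sum_q (\sum_m lam m * (z m).1.2 q) *: (e q).1 +
   (\sum_m lam m * (z m).2) *: euler k n)%R.
  under [X in (_ = X + _)%R]eq_bigr do rewrite scaler_suml.
  rewrite exchange_big /= scaler_suml -big_split; apply: eq_bigr => m _ /=.
  rewrite -scalerA (proj2 (Hz m)) scalerDr scaler_sumr scalerA; congr (_ + _)%R.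
  by apply: eq_bigr => q _; rewrite scalerA.
move=> /(_ E m0)/eqP; rewrite rmorphM mulf_eq0 (negPf (proj1 (Hz m0))) orbF.
by rewrite (negPf lam0).
Qed.
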